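(* Let $\lambda\neq0$, let $\Theta\subset\mathbb{R}^d$ be an open convex set, let $\varphi:\Theta\to\mathbb{R}$ be a regular $c_\lambda$-convex function, put $\Phi_\lambda=\frac1\lambda(e^{\lambda\varphi}-1)$, and let $f:\Theta\to\mathbb{R}$ be differentiable. Let $(\tilde\theta_s)_{s\ge0}$ be the Hessian gradient flow in $\Theta$ with respect to the Bregman generator $\Phi_\lambda$, i.e. $$\frac{d}{ds}\tilde\theta_s=-\bigl(\nabla^2_\theta\Phi_\lambda(\tilde\theta_s)\bigr)^{-1}\nabla_\theta f(\tilde\theta_s).$$ Consider the time change $s=s_t$ with $s_0=0$ and $\frac{d}{dt}s_t=\exp(\lambda\varphi(\tilde\theta_{s_t}))$. Then $\theta_t=\tilde\theta_{s_t}$ is the conformal mirror descent induced by $\varphi$, i.e. $$\frac{d}{dt}\theta_t=-G_\lambda(\theta_t)^{-1}\nabla_\theta f(\theta_t),\qquad \theta_0=\tilde\theta_0.$$ In particular, letting $\zeta_t=\nabla\Phi_\lambda(\theta_t)$ be the dual variable with respect to the Bregman generator $\Phi_\lambda$, the flow can be expressed as $$\frac{d}{dt}\zeta_t=-e^{\lambda\varphi(\theta_t)}\nabla_\theta f(\theta_t).$$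
   Context: Vectors are column vectors, $\langle\cdot,\cdot\rangle$ is the Euclidean inner product, $\nabla_\theta$ is the Euclidean gradient. Fix $\lambda\neq0$. Regular $c_\lambda$-convex function: a smooth function $\varphi:\Theta\to\mathbb{R}$ on an open convex set $\Theta\subset\mathbb{R}^d$ such that $\Phi_\lambda=\frac1\lambda(e^{\lambda\varphi}-1)$ is convex with $\nabla^2_\theta\Phi_\lambda$ positive definite everywhere, and $1-\lambda\langle\nabla_\theta\varphi(\theta),\theta\rangle>0$ for all $\theta\in\Theta$. A Bregman generator is a smooth convex function on an open convex set with everywhere positive definite Hessian. The Riemannian metric induced by the $\lambda$-logarithmic divergence of $\varphi$ has, in the coordinates $\theta$, the matrix $$G_\lambda(\theta)=\nabla^2_\theta\varphi(\theta)+\lambda(\nabla_\theta\varphi(\theta))(\nabla_\theta\varphi(\theta))^\top=e^{-\lambda\varphi(\theta)}\nabla^2_\theta\Phi_\lambda(\theta).$$ The conformal mirror descent is the gradient flow of $f$ with respect to $G_\lambda$. *)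

(* Defs.v *)
From HB Require Import structures.
From mathcomp Require Import all_boot all_order all_algebra.
From mathcomp Require Import all_classical all_reals all_analysis.

Set Implicit Arguments.
Unset Strict Implicit.
Unset Printing Implicit Defensive.

Import Order.TTheory GRing.Theory Num.Theory.
Import numFieldNormedType.Exports.

Local Open Scope classical_set_scope.
Local Open Scope ring_scope.

(* Functions on an open set Theta of R^d are represented by total functions on
   'cV[R]_d; every notion below depends only on their values on Theta. *)

Section Calculus.
Context {R : realType} {d : nat}.
Implicit Types (g : 'cV[R]_d -> R) (D : set 'cV[R]_d) (x u v : 'cV[R]_d).

Definition inner u v : R := (u^T *m v) 0 0.

Definition partial (i : 'I_d) g : 'cV[R]_d -> R :=
  fun x => 'D_(delta_mx i 0) g x.

Definition grad g x : 'cV[R]_d := \col_i partial i g x.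

Definition hess g x : 'M[R]_d := \matrix_(i, j) partial j (partial i g) x.

Fixpoint Ck_on (k : nat) D g : Prop :=
  match k with
  | 0 => forall x, D x -> {for x, continuous g}
  | k'.+1 => (forall x, D x -> differentiable g x) /\
             (forall i, Ck_on k' D (partial i g))
  end.

Definition smooth_on D g : Prop := forall k, Ck_on k D g.

Definition posdef (A : 'M[R]_d) : Prop :=
  forall v, v != 0 -> 0 < inner v (A *m v).

End Calculus.

(* The derivative at t relative to J: two-sided in the interior of J, one-sided
   at an endpoint of an interval J. *)
Definition has_deriv_within {R : realType} {V : normedModType R}
    (J : set R) (c : R -> V) (t : R) (v : V) : Prop :=
  (fun u => (u - t)^-1 *: (c u - c t)) @ within J t^' --> v.

Definition time_interval {R : realType} (T : \bar R) : set R :=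
  [set t | 0 <= t /\ (t%:E < T)%E].

(* The flow of - grad f with respect to the metric whose matrix in the
   coordinates theta is M. *)
Definition gradient_flow {R : realType} {d : nat}
    (M : 'cV[R]_d -> 'M[R]_d) (Theta : set 'cV[R]_d) (f : 'cV[R]_d -> R)
    (J : set R) (c : R -> 'cV[R]_d) : Prop :=
  forall t, J t -> Theta (c t) /\
    has_deriv_within J c t (- (invmx (M (c t)) *m grad f (c t))).

Definition hessian_gradient_flow {R : realType} {d : nat}
    (Phi : 'cV[R]_d -> R) := gradient_flow (hess Phi).

Section CLambda.
Context {R : realType} {d : nat}.
Variables (lam : R) (phi : 'cV[R]_d -> R).

Definition Phi_lam : 'cV[R]_d -> R :=
  fun x => lam^-1 * (expR (lam * phi x) - 1).

Record regular_c_convex (Theta : set 'cV[R]_d) : Prop := {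
  rcc_smooth : smooth_on Theta phi;
  rcc_convex : convex_function Theta Phi_lam;
  rcc_posdef : forall x, Theta x -> posdef (hess Phi_lam x);
  rcc_dual : forall x, Theta x -> 0 < 1 - lam * inner (grad phi x) x
}.

Definition G_lam (x : 'cV[R]_d) : 'M[R]_d :=
  hess phi x + lam *: (grad phi x *m (grad phi x)^T).

Definition conformal_mirror_descent := gradient_flow G_lam.

End CLambda.

(* Main.v *)
Require Import Defs.
From mathcomp Require Import all_boot all_order all_algebra.
From mathcomp Require Import ring.
From mathcomp Require Import all_classical all_reals all_analysis.
Import Order.TTheory GRing.Theory Num.Theory.
Import numFieldNormedType.Exports.
Local Open Scope classical_set_scope.
Local Open Scope ring_scope.

(** The two flows are the same curve run at different speeds.  The Hessian of
    Phi_lam = (e^{lam phi} - 1) / lam is e^{lam phi} G_lam (hess_Phi_lam), so at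
    each point the conformal velocity -G_lam^-1 grad f is e^{lam phi} times the
    velocity -(hess Phi_lam)^-1 grad f of the Hessian flow; the factor
    e^{lam phi} is exactly the speed imposed on s.

    What takes work is that derivatives are one-sided at the initial time.  The
    chain rule for ttheta o s (has_deriv_within_time_change) needs s to map the
    time interval into [0, +oo[ and to avoid the value s t away from t.  Both
    follow from s 0 = 0 and the strict monotonicity of s, which the mean value
    theorem derives from the positivity of the exponential.

    For the dual variable, the chain rule along theta gives
    zeta' = hess Phi_lam(theta) theta' (has_deriv_within_grad_Phi_lam), and the
    Hessian cancels against its inverse in theta', which leaves
    -e^{lam phi} grad f. *)

(** * Derivatives relative to a set of times *)

Section Within.
Context {R : realType}.

Lemma has_deriv_within_ext {V : normedModType R} (J : set R) (c c' : R -> V)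
    (t : R) (v : V) :
  (forall u, J u -> c u = c' u) -> J t ->
  has_deriv_within J c t v -> has_deriv_within J c' t v.
Proof.
move=> cc' Jt; apply: cvg_trans; apply: near_eq_cvg.
by near=> u; rewrite !cc'//; near: u; rewrite near_withinE; near=> u.
Unshelve. all: by end_near. Qed.

Lemma has_deriv_within_cvg {V : normedModType R} {J : set R} {c : R -> V}
    {t : R} {v : V} :
  has_deriv_within J c t v -> c @ within J (nbhs t) --> c t.
Proof.
move=> cv.
have lim0 : (u - t) *: ((u - t)^-1 *: (c u - c t)) @[u --> within J t^'] --> 0.
  rewrite -(scale0r v); apply: cvgZ cv.
  have ut0 : u - t @[u --> t] --> 0.
    by rewrite -(subrr t); apply: cvgB; [exact: cvg_id|exact: cvg_cst].
  apply: cvg_trans ut0; apply: cvg_app.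
  by apply: cvg_trans (cvg_within _) _; exact: cvg_within.
apply/cvgrPdist_lt => e e0.
move/cvgrPdist_lt : lim0 => /(_ _ e0).
rewrite !near_withinE; apply: filterS => u.
have [->|ut] := eqVneq u t; first by move=> _ _; rewrite (subrr (c t)) normr0.
move=> /(_ isT) h Ju; move: (h Ju).
by rewrite scalerA divff ?subr_eq0// scale1r sub0r opprB.
Qed.

(** Write the quotient of c o s as the quotient of s times the quotient of c
    between s t and s u.  The second factor has a limit only because s u tends
    to s t while staying in K and away from s t itself, whence the two
    conditions on s. *)
Lemma has_deriv_within_time_change {V : normedModType R} {J K : set R}
    {s : R -> R} {c : R -> V} {t a : R} {v : V} :
  (forall u, J u -> K (s u)) -> (forall u, J u -> u != t -> s u != s t) ->
  has_deriv_within J s t a -> has_deriv_within K c (s t) v ->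
  has_deriv_within J (c \o s) t (a *: v).
Proof.
move=> JK s_inj sa cv.
have s_cvg : s @ within J t^' --> within K (s t)^'.
  move=> P; rewrite /= !nbhs_simpl /within/= /dnbhs /within/= => hP.
  have := has_deriv_within_cvg sa _ hP.
  rewrite /= !nbhs_simpl /within/=; apply: filterS => u hu ut Ju.
  by apply: hu => //; [exact: s_inj|exact: JK].
have : (s u - s t)^-1 *: (c (s u) - c (s t)) @[u --> within J t^'] --> v.
  exact: cvg_comp s_cvg cv.
move=> /(cvgZ sa); apply: cvg_trans; apply: near_eq_cvg.
rewrite !near_withinE; near=> u => ut Ju.
rewrite scalerA -mulrA divff ?mulr1//.
by rewrite subr_eq0 s_inj.
Unshelve. all: by end_near. Qed.

(** The quotient of F o c is the differential of F applied to the quotient of c,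
    plus a remainder: F(c u) - F(c t) - dF(c u - c t) is o(c u - c t), and the
    quotient of c is bounded near t because it converges. *)
Lemma has_deriv_within_diff {V W : normedModType R} {J : set R}
    {c : R -> V} {F : V -> W} {t : R} {v : V} :
  differentiable F (c t) -> has_deriv_within J c t v ->
  has_deriv_within J (F \o c) t ('d F (c t) v).
Proof.
move=> dF cv.
have Lq : 'd F (c t) ((u - t)^-1 *: (c u - c t)) @[u --> within J t^'] -->
    'd F (c t) v.
  by have := diff_continuous dF => /(_ v); exact: cvg_comp cv.
rewrite /has_deriv_within -[X in _ --> X]addr0.
have -> : (fun u => (u - t)^-1 *: ((F \o c) u - (F \o c) t)) =
  (fun u => 'd F (c t) ((u - t)^-1 *: (c u - c t)) +
     (u - t)^-1 *: (F (c u) - F (c t) - 'd F (c t) (c u - c t))).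
  by apply/funext => u; rewrite linearZ/= -scalerDr addrCA subrr addr0.
apply: cvgD Lq _.
apply/cvgr0Pnorm_le => e e0.
(* |v| + 1 eventually bounds the quotient of c, so an o-constant of
   e / (|v| + 1) makes the remainder at most e. *)
have M0 : 0 < `|v| + 1 by rewrite ltr_wpDl.
have /eqaddoP/(_ (e / (`|v| + 1))) := diff_locally dF.
rewrite divr_gt0// => /(_ isT)/= rem.
have cc : c u - c t @[u --> within J (nbhs t)] --> 0.
  rewrite -(subrr (c t)); apply: cvgB; last exact: cvg_cst.
  exact: has_deriv_within_cvg cv.
have {}rem := cc _ rem.
have : \forall u \near within J t^', `|(u - t)^-1 *: (c u - c t)| < `|v| + 1.
  by apply: (cvgr_norm_lt _ cv); rewrite ltrDl.
move: rem; rewrite /= !nbhs_simpl /within/= /dnbhs /within/=.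
apply: filterS2 => u hrem hq ut Ju.
have := hrem Ju; have := hq ut Ju.
rewrite !fctE/= subrK !normrZ => q1 r1.
rewrite opprD addrA in r1.
apply: le_trans (ler_wpM2l (normr_ge0 _) r1) _.
rewrite mulrCA -mulrA ler_piMr ?(ltW e0)//.
by rewrite mulrC ler_pdivrMr// mul1r ltW.
Qed.

Lemma has_deriv_within_coord {d : nat} {J : set R} {c : R -> 'cV[R]_d}
    {t : R} {v : 'cV[R]_d} :
  (forall i, has_deriv_within J (fun u => c u i 0) t (v i 0)) ->
  has_deriv_within J c t v.
Proof.
move=> ci; apply/cvg_ballP => e e0.
have : \forall u \near within J t^', forall i : 'I_d,
   `|v i 0 - (u - t)^-1 *: (c u i 0 - c t i 0)| < e.
  apply: filter_forall => i.
  move/cvgrPdist_lt : (ci i) => /(_ _ e0); exact.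
apply: filterS => u hu; split=> // i j.
by rewrite ord1 !mxE -ball_normE; exact: hu.
Qed.

Lemma has_deriv_within_is_derive {J : set R} {s : R -> R} {t a : R} :
  nbhs t J -> has_deriv_within J s t a -> is_derive t 1 s a.
Proof.
move=> Jt sa.
have h0 : (h + t) @[h --> 0^'] --> within J t^'.
  move=> P; rewrite /= !nbhs_simpl /within/= /dnbhs /within/= => hP.
  have /= : \forall h \near (0 : R),
      (h + t != t -> J (h + t) -> P (h + t)) /\ J (h + t).
    have cv : h + t @[h --> (0 : R)] --> t.
      rewrite -[X in _ --> X]add0r.
      by apply: cvgD; [exact: cvg_id|exact: cvg_cst].
    by apply: (cv (fun y => (y != t -> J y -> P y) /\ J y)); apply: filterI.
  apply: filterS => h [h1 h2] hN; apply: h1 => //.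
  by rewrite -subr_eq0 addrK.
have lim : h^-1 *: ((s \o shift t) (h *: 1) - s t) @[h --> 0^'] --> a.
  have := cvg_comp _ _ h0 sa; apply: cvg_trans; apply: near_eq_cvg.
  by near=> h; rewrite /= addrK [h *: 1]mulr1.
apply: DeriveDef; first by apply/cvg_ex; exists a.
exact/cvg_lim.
Unshelve. all: by end_near. Qed.

(** On a compact subinterval the relative derivatives are genuine ones in the
    interior and give continuity up to the endpoints, which is what the mean
    value theorem asks for. *)
Lemma has_deriv_within_increasing {T : \bar R} {s ds : R -> R} :
  (forall t, time_interval T t ->
    has_deriv_within (time_interval T) s t (ds t)) ->
  (forall t, 0 < ds t) ->
  forall a b, time_interval T a -> time_interval T b -> a < b -> s a < s b.
Proof.
move=> s_ds ds0 a b [a0 aT] [b0 bT] ab.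
have sub u : a <= u <= b -> time_interval T u.
  move=> /andP[au ub]; split; first exact: le_trans au.
  by apply: le_lt_trans bT; rewrite lee_fin.
have [||c _ sE] := @MVT R s ds a b ab.
- move=> x /[!in_itv]/= /andP[ax xb].
  apply: (@has_deriv_within_is_derive (time_interval T)).
    have : \forall u \near x, u \in `]a, b[.
      by apply: near_in_itvoo; rewrite in_itv/= ax.
    apply: filterS => u /=; rewrite in_itv/= => /andP[/ltW ? /ltW ?].
    exact/sub/andP.
  by apply: s_ds; apply: sub; rewrite !ltW.
- apply/subspace_continuousP => x /=; rewrite in_itv/= => xab.
  move=> P hP; have := has_deriv_within_cvg (s_ds _ (sub _ xab)) _ hP.
  rewrite /= !nbhs_simpl /within/=.
  by apply: filterS => u hu; rewrite in_itv/= => /sub/hu.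
by rewrite -subr_gt0 sE mulr_gt0// subr_gt0.
Qed.

End Within.

(** * The Hessian of Phi_lam *)

Section Calculus.
Context {R : realType} {d : nat}.

Lemma posdef_unitmx (A : 'M[R]_d) : posdef A -> A \in unitmx.
Proof.
move=> A_pos; rewrite -unitmx_tr -row_free_unit -kermx_eq0.
apply/eqP/row_matrixP => i; rewrite row0.
set r := row i _; apply/eqP/negP => /negP r0.
have rA : r *m A^T = 0 by rewrite /r -row_mul mulmx_ker row0.
have := A_pos r^T; rewrite -[r^T == 0]trmx_eq0 trmxK => /(_ r0).
by rewrite -[A]trmxK -trmx_mul rA trmx0 /inner mulmx0 mxE ltxx.
Qed.

Lemma diff_partial (F : 'cV[R]_d -> R) (x v : 'cV[R]_d) :
  differentiable F x -> 'd F x v = \sum_j v j 0 * partial j F x.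
Proof.
move=> dF; rewrite [in LHS](matrix_sum_delta v) linear_sum.
apply: eq_bigr => i _.
by rewrite big_ord1 linearZ/= /partial deriveE.
Qed.

Lemma differentiable_expR_scale (lam : R) {phi : 'cV[R]_d -> R}
    {x : 'cV[R]_d} :
  differentiable phi x -> differentiable (fun y => expR (lam * phi y)) x.
Proof.
move=> dphi; apply: (@differentiable_comp _ _ _ _ (lam *: phi) expR).
  exact: differentiableZ.
by apply/derivable1_diffP.
Qed.

Lemma is_derive_expR_scale (lam : R) {phi : 'cV[R]_d -> R} {x : 'cV[R]_d}
    (v : 'cV[R]_d) :
  differentiable phi x ->
  is_derive x v (fun y => expR (lam * phi y))
    (expR (lam * phi x) * (lam * 'D_v phi x)).
Proof.
move=> dphi.
have dl : differentiable (lam *: phi) x by exact: differentiableZ.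
have de : differentiable (@expR R) (lam * phi x) by apply/derivable1_diffP.
have dE := differentiable_expR_scale lam dphi.
apply: DeriveDef; first exact: diff_derivable.
rewrite -[LHS]/('D_v (expR \o (lam *: phi)) x) deriveE// diff_comp//=.
rewrite diffZ//= (deriveE v dphi) (diff1E de) derive1E derive_val.
by rewrite [LHS]mulrC.
Qed.

Lemma partial_Phi_lam {lam : R} {phi : 'cV[R]_d -> R} {x : 'cV[R]_d} (i : 'I_d) :
  lam != 0 -> differentiable phi x ->
  partial i (Phi_lam lam phi) x = expR (lam * phi x) * partial i phi x.
Proof.
move=> lam0 dphi; rewrite /partial; set v := delta_mx i 0.
have hE := is_derive_expR_scale lam v dphi.
have -> : Phi_lam lam phi =
  lam^-1 *: ((fun y => expR (lam * phi y)) - cst 1) by apply/funext => y.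
by rewrite derive_val /= subr0 [LHS]mulrCA [_^-1 * _]mulrA mulVf// mul1r.
Qed.

(** Differentiating d_i Phi = e^{lam phi} d_i phi once
    more, the exponential contributes the rank-one term
    lam (grad phi)(grad phi)^T of G_lam.  Openness of Theta is what allows the
    first-order identity to be differentiated. *)
Lemma hess_Phi_lam {lam : R} {phi : 'cV[R]_d -> R} {Theta : set 'cV[R]_d}
    {x : 'cV[R]_d} :
  lam != 0 -> open Theta -> Ck_on 2 Theta phi -> Theta x ->
  hess (Phi_lam lam phi) x = expR (lam * phi x) *: G_lam lam phi x.
Proof.
move=> lam0 oT [dphi d2phi] Tx; apply/matrixP => i j.
rewrite !mxE big_ord1 !mxE {1}/partial; set v := delta_mx j 0.
have -> : 'D_v (partial i (Phi_lam lam phi)) x =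
    'D_v ((fun y => expR (lam * phi y)) * partial i phi) x.
  apply: near_eq_derive.
  have : nbhs x Theta by exact: open_nbhs_nbhs.
  by apply: filterS => y Ty; rewrite partial_Phi_lam//; exact: dphi.
have hE := is_derive_expR_scale lam v (dphi _ Tx).
have /(@diff_derivable _ _ _ _ _ v) hp := (d2phi i).1 _ Tx.
rewrite deriveM// derive_val /partial -/v /GRing.scale/= -/v.
ring.
Qed.

(** A chain rule for the gradient map of Phi_lam.  The curve must stay in Theta
    on all of J: this lets each d_i Phi_lam be traded along the curve for
    e^{lam phi} d_i phi, whose differentiability comes from that of phi and of
    its partial derivatives. *)
Lemma has_deriv_within_grad_Phi_lam {lam : R} {phi : 'cV[R]_d -> R}
    {Theta : set 'cV[R]_d} {J : set R} {c : R -> 'cV[R]_d} {t : R}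
    {v : 'cV[R]_d} :
  lam != 0 -> open Theta -> Ck_on 2 Theta phi ->
  (forall u, J u -> Theta (c u)) -> J t -> has_deriv_within J c t v ->
  has_deriv_within J (fun u => grad (Phi_lam lam phi) (c u)) t
    (hess (Phi_lam lam phi) (c t) *m v).
Proof.
move=> lam0 oT [dphi d2phi] cT Jt cv; have Tt := cT t Jt.
apply: has_deriv_within_coord => i.
pose F := (fun y => expR (lam * phi y)) * partial i phi.
have F_partial y : Theta y -> partial i (Phi_lam lam phi) y = F y.
  by move=> Ty; rewrite partial_Phi_lam//; exact: dphi.
have dF : differentiable F (c t).
  apply: differentiableM; last exact: (d2phi i).1.
  by apply: differentiable_expR_scale; exact: dphi.
apply: (@has_deriv_within_ext _ _ _ (F \o c)) => //.
  by move=> u Ju; rewrite mxE F_partial//; exact: cT.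
have -> : (hess (Phi_lam lam phi) (c t) *m v) i 0 = 'd F (c t) v.
  rewrite diff_partial// mxE; apply: eq_bigr => j _; rewrite mulrC.
  congr (_ * _); rewrite mxE; apply: near_eq_derive.
  have : nbhs (c t) Theta by exact: open_nbhs_nbhs.
  by apply: filterS => y; exact: F_partial.
exact: has_deriv_within_diff dF cv.
Qed.

End Calculus.

Theorem theorem2 (R : realType) (d : nat) (lam : R) (Theta : set 'cV[R]_d)
    (phi f : 'cV[R]_d -> R) (ttheta : R -> 'cV[R]_d) (T : \bar R) (s : R -> R)
    (lam_neq0 : lam != 0)
    (Theta_open : open Theta)
    (Theta_convex : convex_set Theta)
    (phi_regular : regular_c_convex lam phi Theta)
    (f_diff : forall x, Theta x -> differentiable f x)
    (ttheta_flow :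
      hessian_gradient_flow (Phi_lam lam phi) Theta f (time_interval +oo) ttheta)
    (T_gt0 : (0 < T)%E)
    (s0 : s 0 = 0)
    (s_deriv : forall t, time_interval T t ->
      has_deriv_within (time_interval T) s t
        (expR (lam * phi (ttheta (s t))))) :
  let theta := fun t => ttheta (s t) in
  let zeta := fun t => grad (Phi_lam lam phi) (theta t) in
  [/\ theta 0 = ttheta 0,
      conformal_mirror_descent lam phi Theta f (time_interval T) theta &
      forall t, time_interval T t ->
        has_deriv_within (time_interval T) zeta t
          (- (expR (lam * phi (theta t)) *: grad f (theta t)))].
Proof.
move=> theta zeta.
have C2 := rcc_smooth phi_regular 2.
have [dphi d2phi] := C2.
have s_lt : forall a b, time_interval T a -> time_interval T b -> a < b ->
    s a < s b.
  exact: has_deriv_within_increasing s_deriv (fun=> expR_gt0 _).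
have J0 : time_interval T 0 by split.
(* The Hessian flow is only given for times s >= 0, so the time change must be
   known to stay nonnegative before the flow equation can be used at s t. *)
have s_ge0 t : time_interval T t -> time_interval +oo (s t).
  move=> Jt; split; last exact: ltry.
  have [t0 _] := Jt; move: t0; rewrite le_eqVlt => /predU1P[<-|t0].
    by rewrite s0.
  by rewrite -s0 ltW// s_lt.
have s_inj t u : time_interval T t -> time_interval T u -> u != t -> s u != s t.
  move=> Jt Ju; rewrite neq_lt => /orP[ut|tu].
    by rewrite lt_eqF// s_lt.
  by rewrite gt_eqF// s_lt.
have theta_in t : time_interval T t -> Theta (theta t).
  by move=> /s_ge0/ttheta_flow[].
have H_unit t : time_interval T t ->
    hess (Phi_lam lam phi) (theta t) \in unitmx.
  by move=> /theta_in /(rcc_posdef phi_regular) /posdef_unitmx.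
have theta_deriv t : time_interval T t ->
    has_deriv_within (time_interval T) theta t
      (expR (lam * phi (theta t)) *:
        - (invmx (hess (Phi_lam lam phi) (theta t)) *m grad f (theta t))).
  move=> Jt; apply: (has_deriv_within_time_change s_ge0 _ (s_deriv t Jt)).
    by move=> u; exact: s_inj.
  by have [] := ttheta_flow _ (s_ge0 t Jt).
split; first by rewrite /theta s0.
- move=> t Jt; split; first exact: theta_in.
  have := theta_deriv t Jt; have := H_unit t Jt.
  rewrite (hess_Phi_lam lam_neq0 Theta_open C2 (theta_in t Jt)) => HU.
  rewrite invmxZ// -scalemxAl scalerN scalerA divff ?scale1r//.
  by rewrite gt_eqF ?expR_gt0.
- move=> t Jt; have := has_deriv_within_grad_Phi_lam lam_neq0 Theta_open C2
    theta_in Jt (theta_deriv t Jt).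
  by rewrite -scalemxAr mulmxN mulKVmx ?H_unit// scalerN.
Qed.
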